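(* Define integers $h_n(i,j)$, $\ell_n(i,j)$ ($n\ge1$, $i,j\in\mathbb Z$) by $h_1(0,0)=1$, $h_1(i,j)=0$ for $(i,j)\ne(0,0)$, and for $n\ge1$ $$\ell_n(i,j)=2h_n(i-2,j-1)+i\,h_n(i,j-2)+(j-1)h_n(i-1,j-1)+2(3n+2-i-2j)h_n(i-1,j-2),$$ $$h_{n+1}(i,j)=(i+1)\ell_n(i+1,j)+(j+1)\ell_n(i,j+1)+2(3n+1-i-2j)\ell_n(i,j)$$ (so that $\ell_1(2,1)=2$ and $\ell_1(i,j)=0$ otherwise). Then for $n\ge1$, $$H_n(x,y,z)=\sum_{i=0}^{2n-2}z^{i}\sum_{j=0}^{\lfloor(3n-3-i)/2\rfloor}h_{n}(i,j)(xy)^{j}(x+y)^{3n-3-i-2j},$$ $$L_n(x,y,z)=\sum_{i=1}^{2n}z^{i}\sum_{j=1}^{\lfloor(3n+1-i)/2\rfloor}\ell_{n}(i,j)(xy)^{j}(x+y)^{3n+1-i-2j}.$$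
   Context: For $n\ge1$, $N_n=\{1,1,\overline1,2,2,\overline2,\dots,n,n,\overline n\}$, ordered by $\overline1=1<\overline2=2<\cdots<\overline n=n$ (a barred and an unbarred copy of the same integer compare as equal). For a sub-multiset $M$ of $N_n$, a Legendre-Stirling permutation of $M$ is a word $\pi_1\cdots\pi_m$ using the elements of $M$ such that whenever $i<j<k$, $\pi_i,\pi_k$ are unbarred and $\pi_i=\pi_k$, then $\pi_j>\pi_i$. $\mathrm{LS}_n$ is the set of Legendre-Stirling permutations of $N_n$, and $\mathrm{LSD}_n$ the set of Legendre-Stirling permutations of $N_n\setminus\{n,n\}$. For such $\pi$ of length $m$ set $\pi_0=\pi_{m+1}=0$; for $0\le i\le m$, $i$ is an ascent, descent or plateau if $\pi_i<\pi_{i+1}$, $\pi_i>\pi_{i+1}$ or $\pi_i=\pi_{i+1}$; $\mathrm{asc},\mathrm{des},\mathrm{plat}$ count them. $H_n(x,y,z)=\sum_{\pi\in\mathrm{LSD}_n}x^{\mathrm{asc}(\pi)-1}y^{\mathrm{des}(\pi)-1}z^{\mathrm{plat}(\pi)}$, $L_n(x,y,z)=\sum_{\pi\in\mathrm{LS}_n}x^{\mathrm{asc}(\pi)}y^{\mathrm{des}(\pi)}z^{\mathrm{plat}(\pi)}$. *)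

(* Defs.v *)
From mathcomp Require Import all_boot all_order all_algebra.
From mathcomp Require Import mpoly.

Set Implicit Arguments.
Unset Strict Implicit.
Unset Printing Implicit Defensive.

Import GRing.Theory.
Local Open Scope ring_scope.

(** (k, false) is the unbarred copy of k and (k, true) the barred one.  Letters
    are always compared through [value], so that k and its barred copy compare
    as equal; [==] on letters distinguishes them. *)
Definition letter : Type := (nat * bool)%type.
Definition value (a : letter) : nat := a.1.
Definition barred (a : letter) : bool := a.2.

(** Multisets of letters are represented by sequences, up to [perm_eq]. *)
Definition Nset (n : nat) : seq letter :=
  flatten [seq [:: (k, false); (k, false); (k, true)] | k <- iota 1 n].

Definition NsetD (n : nat) : seq letter :=
  rem (n, false) (rem (n, false) (Nset n)).

Definition ls_word (w : seq letter) : bool :=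
  let a := nth (0%N, false) w in
  [forall i : 'I_(size w), forall j : 'I_(size w), forall k : 'I_(size w),
     [&& (i < j)%N, (j < k)%N, ~~ barred (a i), ~~ barred (a k)
       & a i == a k] ==> (value (a i) < value (a j))%N].

(** [permutations M] lists each distinct arrangement of M exactly once. *)
Definition LSperms (M : seq letter) : seq (seq letter) :=
  [seq w <- permutations M | ls_word w].

Definition LS (n : nat) := LSperms (Nset n).
Definition LSD (n : nat) := LSperms (NsetD n).

(** [padded w i] is the value of the i-th letter of w, counted from 1, with
    zeros at positions 0 and (size w).+1. *)
Definition padded (w : seq letter) (i : nat) : nat :=
  nth 0%N (0%N :: rcons [seq value a | a <- w] 0%N) i.

Definition asc (w : seq letter) : nat :=
  #|[set i : 'I_(size w).+1 | (padded w i < padded w i.+1)%N]|.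
Definition des (w : seq letter) : nat :=
  #|[set i : 'I_(size w).+1 | (padded w i > padded w i.+1)%N]|.
Definition plat (w : seq letter) : nat :=
  #|[set i : 'I_(size w).+1 | padded w i == padded w i.+1]|.

Definition x : {mpoly int[3]} := 'X_(inord 0).
Definition y : {mpoly int[3]} := 'X_(inord 1).
Definition z : {mpoly int[3]} := 'X_(inord 2).

(** For n >= 1 the words in [LSD n] are nonempty with positive values, so both
    asc and des are at least 1 and the predecessors below do not truncate. *)
Definition H (n : nat) : {mpoly int[3]} :=
  \sum_(w <- LSD n) x ^+ (asc w).-1 * y ^+ (des w).-1 * z ^+ plat w.

Definition L (n : nat) : {mpoly int[3]} :=
  \sum_(w <- LS n) x ^+ asc w * y ^+ des w * z ^+ plat w.

Definition ell_step (n : nat) (h : int -> int -> int) (i j : int) : int :=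
  2 * h (i - 2) (j - 1) + i * h i (j - 2) + (j - 1) * h (i - 1) (j - 1)
  + 2 * (3 * n%:Z + 2 - i - 2 * j) * h (i - 1) (j - 2).

Definition h_step (n : nat) (l : int -> int -> int) (i j : int) : int :=
  (i + 1) * l (i + 1) j + (j + 1) * l i (j + 1)
  + 2 * (3 * n%:Z + 1 - i - 2 * j) * l i j.

(** The value at n = 0 is a placeholder: indices start at 1. *)
Fixpoint h (n : nat) : int -> int -> int :=
  match n with
  | 0 => fun _ _ => 0
  | m.+1 =>
    match m with
    | 0 => fun i j => if (i == 0) && (j == 0) then 1 else 0
    | _.+1 => h_step m (ell_step m (h m))
    end
  end.

Definition ell (n : nat) : int -> int -> int := ell_step n (h n).

Lemma h_rec (n : nat) (i j : int) : (0 < n)%N ->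
  h n.+1 i j = (i + 1) * ell n (i + 1) j + (j + 1) * ell n i (j + 1)
               + 2 * (3 * n%:Z + 1 - i - 2 * j) * ell n i j.
Proof. by case: n. Qed.

(* Main.v *)
(** Let D be the sum of the three partial derivatives, and attach the factor x,
    y or z to each ascent, descent or plateau gap of a word.  Every word of
    LSD_(n+1) arises uniquely by inserting the barred n+1 in a gap of a word of
    LS_n, which replaces the factor of that gap by xy; as D sends each factor
    to 1, Leibniz' rule gives H_(n+1) = D L_n.  Likewise every word of LS_n
    arises by inserting the adjacent pair nn in a gap of a word of LSD_n: the
    two gaps around the barred n contribute 2 x y z^2 H_n and the others
    x^2 y^2 z D H_n, so L_n = 2 x y z^2 H_n + x^2 y^2 z D H_n.  Since D z = 1,
    D (xy) = x + y and D (x + y) = 2, applying these operators to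
    z^i (xy)^j (x+y)^k yields the recurrences for h and ell. *)

Require Import Defs.
From mathcomp Require Import all_boot all_order all_algebra.
From mathcomp Require Import mpoly.
From mathcomp Require Import zify ring.
Import GRing.Theory.
Local Open Scope ring_scope.

Set Implicit Arguments.
Unset Strict Implicit.
Unset Printing Implicit Defensive.

(** * Words and insertions *)

Lemma subseq_cons_nth (T : eqType) (d c : T) (s t : seq T) :
  subseq (c :: t) s ->
  exists i, [/\ (i < size s)%N, nth d s i = c & subseq t (drop i.+1 s)].
Proof.
elim: s => //= e s IH; case: eqP => [<- ts|_ cts].
  by exists 0%N; rewrite /= drop0.
by have [i [i_lt ei si]] := IH cts; exists i.+1.
Qed.

Lemma subseq_nth_drop (T : eqType) (d : T) (s t : seq T) i : (i < size s)%N ->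
  subseq t (drop i.+1 s) -> subseq (nth d s i :: t) (drop i s).
Proof. by move=> i_lt ts; rewrite (drop_nth d i_lt) /= eqxx. Qed.

Lemma drop_subseq_leq (T : eqType) (s : seq T) i j : (i <= j)%N ->
  subseq (drop j s) (drop i s).
Proof. by move=> ij; rewrite -(subnK ij) -drop_drop drop_subseq. Qed.

(** In terms of subsequences the condition visibly passes to subwords, hence survives the deletion
    of letters. *)
Lemma ls_wordP (w : seq letter) :
  reflect (forall a b, ~~ barred a -> subseq [:: a; b; a] w ->
             (value a < value b)%N)
          (ls_word w).
Proof.
pose d : letter := (0%N, false).
apply: (iffP idP) => [lsw a b ua|lsw].
  move=> /(subseq_cons_nth d) [i [is' ei]].
  move=> /(subseq_cons_nth d) [j [js ej]].
  move=> /(subseq_cons_nth d) [k [ks ek _]].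
  move: ks ek js ej; rewrite !nth_drop !size_drop !ltn_subRL => ks ek js ej.
  move/forallP: lsw => /(_ (Ordinal is')) /forallP /(_ (Ordinal js)).
  move=> /forallP /(_ (Ordinal ks)) /implyP /=.
  by rewrite ei ej ek ua eqxx; apply; rewrite !andbT; apply/andP; split; lia.
apply/forallP => i; apply/forallP => j; apply/forallP => k; apply/implyP.
case/and5P => ij jk ui uk /eqP eik; apply: lsw => //.
rewrite {2}eik -[X in subseq _ X]drop0.
apply: subseq_trans (drop_subseq_leq _ (leq0n i)).
apply: subseq_nth_drop => //; apply: subseq_trans (drop_subseq_leq _ ij).
apply: subseq_nth_drop => //; apply: subseq_trans (drop_subseq_leq _ jk).
by apply: subseq_nth_drop => //; apply: sub0seq.
Qed.

Definition insert (k : nat) (b w : seq letter) : seq letter :=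
  take k w ++ b ++ drop k w.

Lemma perm_insert k b w : perm_eq (insert k b w) (b ++ w).
Proof. by rewrite /insert perm_catCA cat_take_drop. Qed.

(** * Insertion of a block of copies of a largest letter *)

Section Insert.

Variables (M M' : seq letter) (c : letter) (r : nat).
Hypothesis permM' : perm_eq M' (nseq r.+1 c ++ M).
(* Three equal unbarred letters are never allowed, hence at most two copies of
   [c] if it is unbarred; only one copy of a barred [c] is ever inserted. *)
Hypothesis r_le : (r <= ~~ barred c)%N.
Hypothesis notinM : c \notin M.
(** Only unbarred letters are strictly smaller: when the pair [n n] is inserted, [M] already
    contains the barred [n]. *)
Hypothesis le_c : {in M, forall a, (value a <= value c)%N}.
Hypothesis lt_c : {in M, forall a, ~~ barred a -> (value a < value c)%N}.

Lemma filter_insert k (w : seq letter) : c \notin w ->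
  [seq a <- insert k (nseq r.+1 c) w | a != c] = w.
Proof.
move=> cw; rewrite /insert !filter_cat.
rewrite [filter _ (nseq _ _)](_ : _ = [::]); last first.
  by apply/eqP; rewrite -size_eq0 size_filter count_nseq /= eqxx.
rewrite /= -filter_cat cat_take_drop; apply/all_filterP/allP => a aw.
by apply: contraNneq cw => <-.
Qed.

Lemma index_insert k (w : seq letter) : c \notin w -> (k <= size w)%N ->
  index c (insert k (nseq r.+1 c) w) = k.
Proof.
move=> cw kw; rewrite /insert index_cat ifN; last first.
  by apply: contra cw => /mem_take.
by rewrite /= eqxx addn0 size_take_min; apply/minn_idPl.
Qed.

(** For a triple [a b a] with [a] different from [c], either [b] is [c], which exceeds every
    unbarred letter of [M], or the triple already lies in [w]. A triple [c b c] cannot occur,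
    because the inserted copies are adjacent. *)
Lemma ls_insert k w : perm_eq w M -> ls_word w ->
  ls_word (insert k (nseq r.+1 c) w).
Proof.
move=> wM /ls_wordP lsw; apply/ls_wordP => a b ua sub.
have cw : c \notin w by rewrite (perm_mem wM).
have mem_ins d : d \in [:: a; b; a] -> (d == c) || (d \in M).
  move=> /(mem_subseq sub); rewrite (perm_mem (perm_insert _ _ _)) mem_cat.
  by rewrite (perm_mem wM) => /orP [/nseqP [->]|->]; rewrite ?eqxx ?orbT.
have [eac|nac] := eqVneq a c; last first.
  have aM : a \in M by have := mem_ins a; rewrite !inE eqxx (negPf nac); exact.
  have [->|nbc] := eqVneq b c; first exact: lt_c.
  apply: lsw => //; rewrite -(filter_insert k cw) subseq_filter sub.
  by rewrite /= nac nbc.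
rewrite {a}eac in ua sub mem_ins *.
have cnt : count_mem c (insert k (nseq r.+1 c) w) = r.+1.
  rewrite (permP (perm_insert _ _ _)) count_cat count_nseq /= eqxx mul1n.
  by rewrite (count_memPn cw) addn0.
have cnt_le : (count_mem c [:: c; b; c] <= r.+1)%N.
  by rewrite -cnt; apply: leq_count_subseq.
have r1 : r = 1%N.
  by move: r_le cnt_le => /=; rewrite ua eqxx; case: (r) => [|[|?]] //; lia.
have nbc : (c == b) = false.
  by apply/negP => /eqP ecb; move: cnt_le; rewrite -ecb /= eqxx r1.
(* The first [c] of the triple may be matched with the first [c] of the word; the last one would
   then have to lie in [drop k w]. *)
have drop1 s t u : c \notin s -> subseq (c :: t) (s ++ c :: u) -> subseq t u.
  elim: s => [|d s IH] /=; first by rewrite eqxx.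
  by rewrite inE negb_or eq_sym => /andP [/negPf -> /IH].
move: sub; rewrite /insert r1 => /drop1 /=; rewrite eq_sym nbc.
have ct : c \notin take k w by apply: contra cw => /mem_take.
move=> /(_ ct) /mem_subseq /(_ c); rewrite !inE eqxx orbT => /(_ isT).
by move=> /mem_drop; rewrite (negPf cw).
Qed.

(** If two copies of [c] were not adjacent, the letter [b] after the first would come from [M], and
    the triple [c b c] would force [b] above the maximum [c]. *)
Lemma ls_insert_inv w' : perm_eq w' M' -> ls_word w' ->
  exists w k, [/\ perm_eq w M, ls_word w, (k <= size w)%N
                & w' = insert k (nseq r.+1 c) w].
Proof.
move=> w'M' lsw'.
have perm' := perm_trans w'M' permM'.
have cnt : count_mem c w' = r.+1.
  rewrite (permP perm') count_cat count_nseq /= eqxx mul1n.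
  by rewrite (count_memPn notinM) addn0.
suff [w1 [w2 e]] : exists w1 w2, w' = w1 ++ nseq r.+1 c ++ w2.
  have e' : w' = insert (size w1) (nseq r.+1 c) (w1 ++ w2).
    by rewrite /insert take_size_cat // drop_size_cat.
  have wM : perm_eq (w1 ++ w2) M.
    rewrite -(perm_cat2l (nseq r.+1 c)); apply: perm_trans perm'.
    by rewrite perm_sym e'; apply: perm_insert.
  exists (w1 ++ w2), (size w1); split=> //; last by rewrite size_cat leq_addr.
  apply/ls_wordP => a b ua sub; move/ls_wordP: lsw'; apply=> //.
  apply: subseq_trans sub _; rewrite e.
  by apply: cat_subseq => //; apply: suffix_subseq.
have cw' : c \in w' by rewrite -has_pred1 has_count cnt.
have e : w' = take (index c w') w' ++ c :: drop (index c w').+1 w'.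
  by rewrite -{1}(cat_take_drop (index c w') w') (drop_nth c) ?index_mem //
             nth_index.
move: e; set s1 := take _ _; set s2 := drop _ _ => e.
exists s1.
have cs1 : c \notin s1.
  by apply/negP => /index_ltn; rewrite ltnn.
have cnt2 : count_mem c s2 = r.
  by move: cnt; rewrite {1}e count_cat /= eqxx (count_memPn cs1) => -[].
have [r0|r1] : r = 0%N \/ r = 1%N by move: r_le; case: (~~ _) => /=; lia.
  by exists s2; rewrite r0.
rewrite r1 in cnt2 *.
have uc : ~~ barred c by move: r_le; rewrite r1; case: (~~ _).
case: s2 cnt2 e => // b s3 cnt2 e.
have [ebc|nbc] := eqVneq b c; first by exists s3; rewrite {1}e ebc.
have cs3 : c \in s3.
  rewrite -has_pred1 has_count; move: cnt2.
  by rewrite /= (negPf nbc) add0n => ->.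
have sub : subseq [:: c; b; c] w'.
  apply: subseq_trans (_ : subseq (c :: b :: s3) _).
    by rewrite /= !eqxx sub1seq.
  by rewrite e suffix_subseq.
have bM : b \in M.
  have : b \in w' by apply: (mem_subseq sub); rewrite !inE eqxx orbT.
  rewrite (perm_mem perm') mem_cat => /orP [/nseqP [ebc]|//].
  by rewrite ebc eqxx in nbc.
by have := elimT (ls_wordP w') lsw' _ _ uc sub; rewrite ltnNge le_c.
Qed.

(** Insertion is a bijection from pairs of a word and a gap: erasing [c] recovers the word, and the
    index of the first [c] recovers the gap. *)
Lemma big_LSperms_insert (V : nmodType) (F : seq letter -> V) :
  \sum_(w' <- LSperms M') F w' =
  \sum_(w <- LSperms M) \sum_(0 <= k < (size w).+1)
     F (insert k (nseq r.+1 c) w).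
Proof.
have cw w : w \in LSperms M -> c \notin w.
  by rewrite mem_filter mem_permutations => /andP [_ /perm_mem ->].
rewrite -(big_allpairs_dep (h := fun w k => insert k (nseq r.+1 c) w)).
apply: perm_big; apply: uniq_perm.
- by rewrite filter_uniq // permutations_uniq.
- apply: allpairs_uniq_dep => [|w _|].
  + by rewrite filter_uniq // permutations_uniq.
  + exact: iota_uniq.
  move=> p1 p2 /allpairsPdep [w1 [k1 [w1M k1w ep1]]].
  move=> /allpairsPdep [w2 [k2 [w2M k2w ep2]]]; rewrite {p1}ep1 {p2}ep2 /= => e.
  have ew : w1 = w2.
    by rewrite -(filter_insert k1 (cw _ w1M)) e filter_insert ?cw.
  move: k1w k2w; rewrite !mem_index_iota !ltnS /= => k1w k2w.
  have ek : k1 = k2.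
    by rewrite -(index_insert (cw _ w1M) k1w) e index_insert ?cw.
  by rewrite ew ek.
move=> w'; rewrite mem_filter mem_permutations; apply/andP/allpairsPdep.
  case=> lsw' w'M'; have [w [k [wM lsw kw e]]] := ls_insert_inv w'M' lsw'.
  exists w, k; split=> //; last by rewrite mem_index_iota ltnS.
  by rewrite mem_filter lsw mem_permutations.
case=> w [k []]; rewrite mem_filter mem_permutations => /andP [lsw wM] _ ->.
split; first exact: ls_insert.
apply: perm_trans (perm_insert _ _ _) _.
by rewrite perm_sym (perm_trans permM') // perm_cat2l perm_sym.
Qed.

End Insert.

(** * The two insertions that build [LSD] and [LS] *)

Lemma value_Nset n a : a \in Nset n -> (0 < value a <= n)%N.
Proof.
move=> /flatten_mapP [k]; rewrite mem_iota !inE => k_le.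
by case/or3P=> /eqP -> /=; lia.
Qed.

Lemma perm_Nset3 n :
  perm_eq (Nset n.+1)
    ((n.+1, false) :: (n.+1, false) :: (n.+1, true) :: Nset n).
Proof.
rewrite /Nset -(addn1 n) iotaD map_cat flatten_cat /= add1n addn1.
by rewrite perm_catC.
Qed.

Lemma perm_rem_cons (T : eqType) (a : T) s t :
  perm_eq s (a :: t) -> perm_eq (rem a s) t.
Proof.
move=> st; rewrite -(perm_cons a); apply: perm_trans (st).
by rewrite perm_sym perm_to_rem // (perm_mem st) mem_head.
Qed.

Lemma perm_NsetD n : perm_eq (NsetD n.+1) ((n.+1, true) :: Nset n).
Proof. by do 2!apply: perm_rem_cons; apply: perm_Nset3. Qed.

Lemma perm_Nset n : perm_eq (Nset n.+1) (nseq 2 (n.+1, false) ++ NsetD n.+1).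
Proof.
apply: perm_trans (perm_Nset3 n) _.
by rewrite !perm_cons perm_sym perm_NsetD.
Qed.

Lemma big_LSD (V : nmodType) n (F : seq letter -> V) :
  \sum_(w <- LSD n.+1) F w =
  \sum_(w <- LS n) \sum_(0 <= k < (size w).+1) F (insert k [:: (n.+1, true)] w).
Proof.
rewrite /LSD.
rewrite (big_LSperms_insert (M := Nset n) (c := (n.+1, true)) (r := 0)) //=.
- exact: perm_NsetD.
- by apply/negP => /value_Nset /=; lia.
- by move=> a /value_Nset /= ; lia.
- by move=> a /value_Nset /= ; lia.
Qed.

Lemma big_LS (V : nmodType) n (F : seq letter -> V) :
  \sum_(w <- LS n.+1) F w =
  \sum_(w <- LSD n.+1) \sum_(0 <= k < (size w).+1)
     F (insert k (nseq 2 (n.+1, false)) w).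
Proof.
rewrite /LS.
rewrite (big_LSperms_insert (M := NsetD n.+1) (c := (n.+1, false)) (r := 1)) //=.
- exact: perm_Nset.
- rewrite (perm_mem (perm_NsetD n)) inE xpair_eqE andbF.
  by apply/negP => /value_Nset /=; lia.
- move=> a; rewrite (perm_mem (perm_NsetD n)) inE => /orP [/eqP -> //|].
  by move=> /value_Nset /=; lia.
- move=> a; rewrite (perm_mem (perm_NsetD n)) inE => /orP [/eqP -> //|].
  by move=> /value_Nset /=; lia.
Qed.

(** * Weights and derivation *)

Lemma addr3ACA (V : nmodType) (a1 a2 a3 b1 b2 b3 : V) :
  (a1 + b1) + (a2 + b2) + (a3 + b3) = (a1 + a2 + a3) + (b1 + b2 + b3).
Proof. by rewrite (addrACA a1) addrACA. Qed.

Definition D (p : {mpoly int[3]}) : {mpoly int[3]} :=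
  p^`M(inord 0) + p^`M(inord 1) + p^`M(inord 2).

Lemma D0 : D 0 = 0.
Proof. by rewrite /D !mderiv0 !addr0. Qed.

Lemma DD p q : D (p + q) = D p + D q.
Proof. by rewrite /D !mderivD addr3ACA. Qed.

Lemma DM p q : D (p * q) = D p * q + p * D q.
Proof. by rewrite /D !mderivM !mulrDl !mulrDr addr3ACA. Qed.

Lemma D_sum I (r : seq I) (F : I -> {mpoly int[3]}) :
  D (\sum_(i <- r) F i) = \sum_(i <- r) D (F i).
Proof. exact: (big_morph D DD D0). Qed.

Lemma D1 : D 1 = 0.
Proof. by apply: (addrI (D 1)); rewrite addr0 -{3}[1]mulr1 DM mulr1 mul1r. Qed.

Lemma DMint c p : D (c%:~R * p) = c%:~R * D p.
Proof. by rewrite !mulrzl /D !raddfMz -!mulrzDl. Qed.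

Lemma D_var (i : 'I_3) : D 'X_i = 1.
Proof.
rewrite /D !mderivX !mnmE.
have -> : i = inord i by rewrite inord_val.
case: i => [[|[|[|]]]] //= _; rewrite -!val_eqE /= !inordK //=;
by rewrite !scale0r ?addr0 ?add0r scale1r -mpolyX0; congr ('X_[_]);
  apply/mnmP => j; rewrite !mnmE subnn.
Qed.

Lemma Dx : D x = 1. Proof. exact: D_var. Qed.
Lemma Dy : D y = 1. Proof. exact: D_var. Qed.
Lemma Dz : D z = 1. Proof. exact: D_var. Qed.

Lemma DX p k : D (p ^+ k) = k%:R * p ^+ k.-1 * D p.
Proof.
elim: k => [|k IH]; first by rewrite expr0 D1 !mul0r.
rewrite exprS DM IH; case: k {IH} => [|k] /=; first by ring.
by rewrite -natr1 !exprS; ring.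
Qed.

Definition gap (a b : nat) : {mpoly int[3]} :=
  if (a < b)%N then x else if (b < a)%N then y else z.

(** Here [a] is the value just before [s]; keeping it variable allows induction along the word. *)
Fixpoint path_weight (a : nat) (s : seq nat) : {mpoly int[3]} :=
  if s is b :: s' then gap a b * path_weight b s' else 1.

Definition weight (w : seq letter) : {mpoly int[3]} :=
  x ^+ asc w * y ^+ des w * z ^+ plat w.

Lemma D_gap a b : D (gap a b) = 1.
Proof. by rewrite /gap; case: ltngtP => _; rewrite ?Dx ?Dy ?Dz. Qed.

Lemma gap_lt a b : (a < b)%N -> gap a b = x.
Proof. by rewrite /gap => ->. Qed.

Lemma gap_gt a b : (b < a)%N -> gap a b = y.
Proof. by rewrite /gap => ba; rewrite ba ltnNge ltnW. Qed.

Lemma gap_id a : gap a a = z.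
Proof. by rewrite /gap ltnn. Qed.

Lemma path_weightE a s :
  path_weight a s =
  \prod_(i < size s) gap (nth 0%N (a :: s) i) (nth 0%N (a :: s) i.+1).
Proof.
elim: s a => [|b s IH] a /=; first by rewrite big_ord0.
by rewrite big_ord_recl IH.
Qed.

Definition values (w : seq letter) : seq nat := [seq value a | a <- w].

Lemma weightE w : weight w = path_weight 0 (rcons (values w) 0).
Proof.
rewrite path_weightE size_rcons size_map /weight /asc /des /plat.
(* Each power becomes a product over all gaps, so that the three products merge gap by gap. *)
have exp_card (p : {mpoly int[3]}) n (A : pred 'I_n) :
    p ^+ #|[set i | A i]| = \prod_(i < n) (if A i then p else 1).
  by rewrite -big_mkcond -prodr_const; apply: eq_bigl => i; rewrite inE.
rewrite !exp_card -!big_split /=; apply: eq_bigr => i _; rewrite /gap.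
rewrite -/(padded w i) -/(padded w i.+1).
by case: ltngtP; rewrite ?mulr1 ?mul1r.
Qed.

(** Induction peels off the first gap. Inserting there trades its factor for [x * y * z ^+ r],
    inserting later keeps it: these are the two terms of Leibniz' rule, since [D] sends a gap factor
    to 1. *)
Lemma sum_insert_path m r a s : (a < m)%N -> all (ltn^~ m) s ->
  \sum_(0 <= k < size s)
     path_weight a (take k s ++ nseq r.+1 m ++ drop k s) =
  x * y * z ^+ r * D (path_weight a s).
Proof.
have block b t : (b < m)%N ->
    path_weight m (nseq r m ++ b :: t) = z ^+ r * (y * path_weight b t).
  move=> bm; elim: r => [|q IH] /=; first by rewrite gap_gt // mul1r.
  by rewrite IH gap_id exprS !mulrA.
elim: s a => [|b s IH] a am; first by rewrite big_geq //= D1 mulr0.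
case/andP => bm sm; rewrite big_nat_recl //=.
rewrite -big_distrr /= IH // block // gap_lt // DM D_gap.
ring.
Qed.

(** The polynomial [q] is the weight without the ascent into [m] and the descent out of it. Each of
    these two gaps yields [x * y * z ^+ 2 * q]; the remaining gaps are those counted by [D q]. *)
Lemma sum_insert_path_max m a s1 s2 : (a < m)%N ->
  all (ltn^~ m) s1 -> all (ltn^~ m) s2 -> s2 != [::] ->
  exists2 q, path_weight a (s1 ++ m :: s2) = x * y * q &
    \sum_(0 <= k < size (s1 ++ m :: s2))
       path_weight a
         (take k (s1 ++ m :: s2) ++ nseq 2 m ++ drop k (s1 ++ m :: s2))
    = x * y * (2 * z ^+ 2 * q + x * y * z * D q).
Proof.
move=> am; elim: s1 a am => [|b s1 IH] a am /= s1m s2m s2n.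
  case: s2 s2m s2n => //= b s2 /andP [bm s2m] _.
  exists (path_weight b s2); first by rewrite gap_lt // gap_gt // mulrA.
  (* The two gaps around [m] are split off; to the right of them all values are below [m]. *)
  rewrite big_nat_recl // big_nat_recl //= -!big_distrr /=.
  rewrite (sum_insert_path 1 bm s2m).
  by rewrite !gap_id gap_lt // gap_gt //; ring.
have /andP [bm {}s1m] := s1m.
have [q Eq Es] := IH b bm s1m s2m s2n.
exists (gap a b * q); first by rewrite Eq; ring.
rewrite big_nat_recl //= -big_distrr /= Es.
by rewrite gap_id gap_lt // gap_gt // Eq DM D_gap; ring.
Qed.

Lemma rcons_values_insert k r c w : (k <= size w)%N ->
  rcons (values (insert k (nseq r c) w)) 0%N =
  take k (rcons (values w) 0%N) ++ nseq r (value c)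
    ++ drop k (rcons (values w) 0%N).
Proof.
move=> kw; rewrite drop_rcons ?size_map // -!cats1 takel_cat ?size_map //.
by rewrite /values -map_take -map_drop !map_cat map_nseq -!catA.
Qed.

Lemma sum_weight_insert n r c w :
  value c = n.+1 -> all (ltn^~ n.+1) (values w) ->
  \sum_(0 <= k < (size w).+1) weight (insert k (nseq r.+1 c) w)
  = x * y * z ^+ r * D (weight w).
Proof.
move=> cn ltw.
rewrite [in RHS]weightE -(sum_insert_path (m := n.+1)) ?all_rcons //.
rewrite size_rcons size_map; apply: eq_big_nat => k /andP [_ kw].
by rewrite weightE rcons_values_insert // cn.
Qed.

Definition weightD (w : seq letter) : {mpoly int[3]} :=
  x ^+ (asc w).-1 * y ^+ (des w).-1 * z ^+ plat w.

Lemma value_LS n w : w \in LS n -> all (ltn^~ n.+1) (values w).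
Proof.
rewrite mem_filter mem_permutations => /andP [_ /perm_mem wN].
by rewrite all_map; apply/allP => a; rewrite wN => /value_Nset /=; lia.
Qed.

Lemma asc_gt0 a w : (0 < value a)%N -> (0 < asc (a :: w))%N.
Proof. by move=> a_gt0; apply/card_gt0P; exists ord0; rewrite inE. Qed.

Lemma des_gt0 a w : (0 < value a)%N -> (0 < des (rcons w a))%N.
Proof.
move=> a_gt0; apply/card_gt0P; exists ord_max; rewrite inE /padded /=.
rewrite map_rcons nth_rcons !size_rcons size_map ltnn eqxx.
by rewrite /= -cats1 -cats1 -catA nth_cat /= size_map ltnn subnn.
Qed.

(** The gap after the initial 0 is an ascent and the one before the final 0 a descent, so neither
    predecessor truncates. *)
Lemma weightDE n w : w \in LSD n.+1 -> x * y * weightD w = weight w.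
Proof.
rewrite mem_filter mem_permutations => /andP [_ wN].
have {}wN := perm_trans wN (perm_NsetD n).
have pos a : a \in w -> (0 < value a)%N.
  by rewrite (perm_mem wN) inE => /orP [/eqP ->|/value_Nset /andP []].
have ascw : (0 < asc w)%N.
  case: w wN pos => [/perm_size//|a w _ pos].
  by apply: asc_gt0; apply: pos; rewrite mem_head.
have desw : (0 < des w)%N.
  case/lastP: w wN pos {ascw} => [/perm_size//|w a _ pos].
  by apply: des_gt0; apply: pos; rewrite mem_rcons mem_head.
rewrite /weight /weightD -(prednK ascw) -(prednK desw) !exprS /=.
ring.
Qed.

Lemma xyI : injective ( *%R (x * y)).
Proof.
(* A polynomial with nonzero image under [D] is nonzero. *)
have neq0 p : D p = 1 -> p != 0.
  by apply: contra_eq_neq => ->; rewrite D0 eq_sym oner_eq0.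
by apply: mulfI; rewrite mulf_neq0 // neq0 ?Dx ?Dy.
Qed.

(** The case [n = 0] is included: the empty word, of weight [z], gives [H 1]. *)
Lemma H_derivL n : H n.+1 = D (L n).
Proof.
apply: xyI; rewrite /H big_distrr /=.
rewrite (eq_big_seq weight) => [|w]; last exact: weightDE.
rewrite big_LSD /L D_sum big_distrr /=; apply: eq_big_seq => w wL.
rewrite (sum_weight_insert 0 (n := n)) ?expr0 ?mulr1 //; exact: value_LS.
Qed.

Lemma sum_weight_insert_LSD n w : w \in LSD n.+1 ->
  \sum_(0 <= k < (size w).+1) weight (insert k (nseq 2 (n.+1, false)) w)
  = x * y * (2 * z ^+ 2 * weightD w + x * y * z * D (weightD w)).
Proof.
move=> wL; have wDE := weightDE wL.
move: wL; rewrite mem_filter mem_permutations => /andP [_ wN].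
have {}wN := perm_trans wN (perm_NsetD n).
have nw : (n.+1, true) \in w by rewrite (perm_mem wN) mem_head.
have [w1 [w2 ew]] : exists w1 w2, w = w1 ++ (n.+1, true) :: w2.
  by case/splitPr: nw => w1 w2; exists w1, w2.
(* Without its barred maximum, [w] is an arrangement of [Nset n]. *)
have ltw : all (ltn^~ n.+1) (values (w1 ++ w2)).
  rewrite all_map; apply/allP => a.
  have /perm_mem -> : perm_eq (w1 ++ w2) (Nset n).
    rewrite -(perm_cons (n.+1, true)); apply: perm_trans (wN).
    by rewrite ew perm_sym -(cat1s _ w2) perm_catCA.
  by move=> /value_Nset /=; lia.
move: ltw; rewrite /values map_cat all_cat => /andP [lt1 lt2].
have ev : rcons (values w) 0%N = values w1 ++ n.+1 :: rcons (values w2) 0%N.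
  by rewrite ew /values map_cat rcons_cat.
have [||q Eq Es] :=
  sum_insert_path_max (ltn0Sn n) lt1 (s2 := rcons (values w2) 0%N).
- by rewrite all_rcons.
- by rewrite -size_eq0 size_rcons.
have -> : weightD w = q by apply: xyI; rewrite wDE weightE ev Eq.
rewrite -Es -ev size_rcons size_map; apply: eq_big_nat => k /andP [_ kw].
by rewrite weightE rcons_values_insert.
Qed.

Lemma L_derivH n :
  L n.+1 = x * y * (2 * z ^+ 2 * H n.+1 + x * y * z * D (H n.+1)).
Proof.
rewrite /L /H big_LS D_sum !big_distrr -big_split big_distrr /=.
by apply: eq_big_seq => w; exact: sum_weight_insert_LSD.
Qed.

(** * Expansions in z, xy and x + y *)

(** The region where the exponents of [z], [x * y] and [x + y] in a monomial of total degree [d] are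
    all nonnegative. *)
Definition in_cone (d i j : int) : bool := [&& 0 <= i, 0 <= j & i + 2 * j <= d].

Definition supported (d : int) (f : int -> int -> int) : Prop :=
  forall i j, f i j = 0 \/ in_cone d i j.

(** Outside the cone [absz] gives meaningless exponents; there the coefficient [c] will be 0. *)
Definition mono (d c i j : int) : {mpoly int[3]} :=
  c%:~R * (z ^+ absz i * (x * y) ^+ absz j * (x + y) ^+ absz (d - i - 2 * j)%R).

(** A square range, larger than the support, stays the same under all index shifts. *)
Definition expansion (N : nat) (d : int) (f : int -> int -> int) :=
  \sum_(0 <= i < N) \sum_(0 <= j < N) mono d (f i j) i j.

Lemma mono0 d i j : mono d 0 i j = 0.
Proof. by rewrite /mono mul0r. Qed.

Lemma mul_z_mono d c i j : 0 <= i ->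
  z * mono d c i j = mono (d + 1) c (i + 1) j.
Proof.
case: i => // i _; rewrite /mono (_ : d + 1 - _ = d - i%:Z); last by ring.
by rewrite -PoszD addn1 !absz_nat exprS; ring.
Qed.

Lemma mul_xy_mono d c i j : 0 <= j ->
  x * y * mono d c i j = mono (d + 2) c i (j + 1).
Proof.
case: j => // j _; rewrite /mono.
rewrite (_ : d + 2 - i - _ = d - i - 2 * j%:Z); last by ring.
by rewrite -PoszD addn1 !absz_nat exprS; ring.
Qed.

Lemma D_mono d c i j : in_cone d i j ->
  D (mono d c i j) = mono (d - 1) (i * c) (i - 1) j
    + mono (d - 1) (j * c) i (j - 1)
    + mono (d - 1) (2 * (d - i - 2 * j) * c) i j.
Proof.
case/and3P; case: i => // a _; case: j => // b _ abd.
have [k ->] : exists k : nat, d = k%:Z + a%:Z + 2 * b%:Z.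
  by exists (absz (d - a%:Z - 2 * b%:Z)%R); lia.
rewrite /mono DMint !DM !DX DM DD Dx Dy Dz.
rewrite (_ : _ - a%:Z - 2 * b%:Z = k%:Z); last by ring.
rewrite (_ : _ - (a%:Z - 1) - _ = k%:Z); last by ring.
rewrite (_ : _ - a%:Z - 2 * (b%:Z - 1) = k.+1%:Z); last by rewrite intS; ring.
rewrite (_ : _ - a%:Z - 2 * b%:Z = k%:Z - 1); last by ring.
rewrite !absz_nat.
(* The exponents [m.-1] and [absz (m - 1)] differ at [m = 0], where the factor [m] vanishes. *)
have pred_absz (m : nat) (p : {mpoly int[3]}) :
    m%:R * p ^+ m.-1 = m%:~R * p ^+ absz (m%:Z - 1)%R.
  case: m => [|m]; first by rewrite !mul0r.
  by congr (_ * _ ^+ _); lia.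
rewrite !rmorphM /= exprS.
have := pred_absz a z; have := pred_absz b (x * y); have := pred_absz k (x + y).
move: (z ^+ _.-1) (z ^+ absz _) => za za'.
move: ((x * y) ^+ _.-1) ((x * y) ^+ absz _) => ub ub'.
move: ((x + y) ^+ _.-1) ((x + y) ^+ absz _) => sk sk' ek eb ea.
rewrite ea eb ek; ring.
Qed.

Lemma sum_shift (V : nmodType) (N : nat) (g : int -> V) : g 0 = 0 -> g N = 0 ->
  \sum_(0 <= i < N) g (i%:Z + 1) = \sum_(0 <= i < N) g i%:Z.
Proof.
move=> g0 gN.
have := @big_nat_recl _ 0 +%R N 0 (fun i => g i%:Z) (leq0n N).
rewrite big_nat_recr //= gN addr0 g0 add0r => ->.
by apply: eq_bigr => i _; rewrite -addn1 PoszD.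
Qed.

Section Expansion.

Variable N : nat.

Lemma eq_expansion d d' f g : d = d' -> f =2 g ->
  expansion N d f = expansion N d' g.
Proof. by move=> -> fg; do 2!apply: eq_bigr => ? _; rewrite fg. Qed.

Lemma expansionD d f g :
  expansion N d f + expansion N d g = expansion N d (fun i j => f i j + g i j).
Proof.
rewrite /expansion -big_split /=; apply: eq_bigr => i _; rewrite -big_split /=.
by apply: eq_bigr => j _; rewrite /mono intrD [RHS]mulrDl.
Qed.

Lemma expansionZ c d f :
  c%:~R * expansion N d f = expansion N d (fun i j => c * f i j).
Proof.
rewrite /expansion big_distrr /=; apply: eq_bigr => i _; rewrite big_distrr /=.
by apply: eq_bigr => j _; rewrite /mono intrM mulrA.
Qed.

Variables (d : int) (f : int -> int -> int).
Hypotheses (supp_f : supported d f) (d_lt : d + 1 < N%:Z).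

Lemma supp0 i j : ~~ in_cone d i j -> f i j = 0.
Proof. by case: (supp_f i j) => // ->. Qed.

Lemma mul_z_expansion :
  z * expansion N d f = expansion N (d + 1) (fun i j => f (i - 1) j).
Proof.
rewrite /expansion -[RHS](sum_shift (g := fun i : int =>
  \sum_(0 <= j < N) mono (d + 1) (f (i - 1) j) i j)).
- rewrite big_distrr /=; apply: eq_bigr => i _; rewrite big_distrr /=.
  by apply: eq_bigr => j _; rewrite addrK; apply: mul_z_mono.
- by rewrite big1 // => j _; rewrite supp0 ?mono0 // /in_cone; lia.
- by rewrite big1 // => j _; rewrite supp0 ?mono0 // /in_cone; lia.
Qed.

Lemma mul_xy_expansion :
  x * y * expansion N d f = expansion N (d + 2) (fun i j => f i (j - 1)).
Proof.
rewrite /expansion big_distrr /=; apply: eq_bigr => i _.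
rewrite -[RHS](sum_shift (g := fun j : int => mono (d + 2) (f i (j - 1)) i j)).
- rewrite big_distrr /=; apply: eq_bigr => j _.
  by rewrite addrK; apply: mul_xy_mono.
- by rewrite supp0 ?mono0 // /in_cone; lia.
- by rewrite supp0 ?mono0 // /in_cone; lia.
Qed.

(** For [d = 3 * n + 1] this is [h_step n]. *)
Definition deriv_coef (i j : int) : int :=
  (i + 1) * f (i + 1) j + (j + 1) * f i (j + 1) + 2 * (d - i - 2 * j) * f i j.

Lemma D_expansion : D (expansion N d f) = expansion N (d - 1) deriv_coef.
Proof.
rewrite -!expansionD /expansion.
(* Reindexing brings together all terms that carry the same [f i j], so that [D_mono] applies
   termwise. *)
have -> : \sum_(0 <= i < N) \sum_(0 <= j < N)
      mono (d - 1) ((i%:Z + 1) * f (i%:Z + 1) j) i j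
    = \sum_(0 <= i < N) \sum_(0 <= j < N)
        mono (d - 1) (i%:Z * f i j) (i%:Z - 1) j.
  rewrite -[RHS](sum_shift (g := fun i : int =>
    \sum_(0 <= j < N) mono (d - 1) (i * f i j) (i - 1) j)).
  - by do 2!apply: eq_bigr => ? _; rewrite addrK.
  - by rewrite big1 // => j _; rewrite mul0r mono0.
  - by rewrite big1 // => j _; rewrite supp0 ?mulr0 ?mono0 // /in_cone; lia.
have -> : \sum_(0 <= i < N) \sum_(0 <= j < N)
      mono (d - 1) ((j%:Z + 1) * f i (j%:Z + 1)) i j
    = \sum_(0 <= i < N) \sum_(0 <= j < N)
        mono (d - 1) (j%:Z * f i j) i (j%:Z - 1).
  apply: eq_bigr => i _; rewrite -[RHS](sum_shift (g := fun j : int =>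
    mono (d - 1) (j * f i j) i (j - 1))).
  - by apply: eq_bigr => ? _; rewrite addrK.
  - by rewrite mul0r mono0.
  - by rewrite supp0 ?mulr0 ?mono0 // /in_cone; lia.
rewrite D_sum -!big_split /=; apply: eq_bigr => i _.
rewrite D_sum -!big_split /=; apply: eq_bigr => j _.
case: (supp_f i j) => [->|]; last exact: D_mono.
by rewrite !mulr0 !mono0 D0 !addr0.
Qed.

End Expansion.

Lemma mulr_supp (P Q : bool) (c v : int) :
  v = 0 \/ P -> (P -> Q \/ c = 0) -> c * v = 0 \/ Q.
Proof.
move=> [->|Pt] imp; first by left; rewrite mulr0.
by case: (imp Pt) => [|->]; [right | left; rewrite mul0r].
Qed.

Lemma addr_supp (Q : bool) (u v : int) :
  u = 0 \/ Q -> v = 0 \/ Q -> u + v = 0 \/ Q.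
Proof. by move=> [->|?] [->|?]; auto; left; rewrite addr0. Qed.

Lemma supported_deriv d f : supported d f -> supported (d - 1) (deriv_coef d f).
Proof.
move=> supp_f i j; apply: addr_supp; first apply: addr_supp;
  by apply: mulr_supp (supp_f _ _) _; rewrite /in_cone; lia.
Qed.

(** * Supports of [h] and [ell] *)

Definition h_support (n : nat) (i j : int) : bool :=
  [&& 0 <= i <= 2 * n%:Z - 2, 0 <= j & i + 2 * j <= 3 * n%:Z - 3].

Definition ell_support (n : nat) (i j : int) : bool :=
  [&& 1 <= i <= 2 * n%:Z, 1 <= j & i + 2 * j <= 3 * n%:Z + 1].

(** A shifted index leaves the region only where its factor vanishes: [i] at [i = 0], and
    [3 * n + 2 - i - 2 * j] just beyond the upper edge. *)
Lemma ell_supp_of_h n : (forall i j, h n i j = 0 \/ h_support n i j) ->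
  forall i j, ell n i j = 0 \/ ell_support n i j.
Proof.
move=> supp_h i j; rewrite /ell /ell_step; repeat apply: addr_supp;
  apply: mulr_supp (supp_h _ _) _;
  rewrite /h_support /ell_support; lia.
Qed.

Lemma h_supp n i j : h n.+1 i j = 0 \/ h_support n.+1 i j.
Proof.
elim: n i j => [|n IH] i j.
  by rewrite /=; case: ifP => [/andP [/eqP -> /eqP ->]|_]; [right|left].
rewrite h_rec //; repeat apply: addr_supp;
  apply: mulr_supp (ell_supp_of_h IH _ _) _;
  rewrite /h_support /ell_support; lia.
Qed.

Lemma ell_supp n i j : ell n.+1 i j = 0 \/ ell_support n.+1 i j.
Proof. by apply: ell_supp_of_h; apply: h_supp. Qed.

Lemma supported_shift_z d f :
  supported d f -> supported (d + 1) (fun i j => f (i - 1) j).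
Proof.
move=> supp_f i j; case: (supp_f (i - 1) j); first by left.
by rewrite /in_cone; right; lia.
Qed.

Lemma supported_shift_xy d f :
  supported d f -> supported (d + 2) (fun i j => f i (j - 1)).
Proof.
move=> supp_f i j; case: (supp_f i (j - 1)); first by left.
by rewrite /in_cone; right; lia.
Qed.

Lemma supported_h n : supported (3 * n%:Z) (h n.+1).
Proof.
move=> i j; case: (h_supp n i j); first by left.
by rewrite /h_support /in_cone; right; lia.
Qed.

Lemma supported_ell n : supported (3 * n%:Z + 4) (ell n.+1).
Proof.
move=> i j; case: (ell_supp n i j); first by left.
by rewrite /ell_support /in_cone; right; lia.
Qed.

Lemma L_expansion_of_H n N : (3 * n + 10 < N)%N ->
  H n.+1 = expansion N (3 * n%:Z) (h n.+1) ->
  L n.+1 = expansion N (3 * n%:Z + 4) (ell n.+1).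
Proof.
move=> ltN eH; rewrite L_derivH eH.
set E := expansion N _ _; have sh := @supported_h n.
(* Regrouped as successive products by [z] and [x * y], each of which is an index shift; both
   summands end in degree [3 * n + 4]. *)
have -> : x * y * (2 * z ^+ 2 * E + x * y * z * D E) =
    2%:~R * (x * y * (z * (z * E))) + x * y * (x * y * (z * D E)).
  by ring.
have sz := supported_shift_z sh; have sz2 := supported_shift_z sz.
have sd := supported_deriv sh; have sdz := supported_shift_z sd.
have sdzu := supported_shift_xy sdz.
rewrite {}/E D_expansion ?mul_z_expansion ?mul_xy_expansion //; try lia.
rewrite expansionZ (@eq_expansion _ _ (3 * n%:Z + 4) _ _ _ (fun _ _ => erefl)).
  rewrite (@eq_expansion _ (_ + _ + _) (3 * n%:Z + 4) _ _ _ (fun _ _ => erefl)).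
    rewrite expansionD; apply: eq_expansion => // i j.
    rewrite /ell /ell_step /deriv_coef !subrK.
    have sub11 (k : int) : k - 1 - 1 = k - 2 by ring.
    by rewrite !sub11 intS; ring.
  by ring.
by ring.
Qed.

Lemma h1_expansion N : (0 < N)%N -> expansion N 0 (h 1) = 1.
Proof.
case: N => // N _; rewrite /expansion big_nat_recl //.
rewrite [X in _ + X]big1 => [|i _]; last first.
  by apply: big1 => j _; exact: mono0.
rewrite big_nat_recl // [X in _ + X + _]big1 => [|j _]; last exact: mono0.
by rewrite /mono /= !mul1r !addr0.
Qed.

(** The empty word has a single gap, between the two padding zeros, which is a plateau. *)
Lemma L0 : L 0 = z.
Proof.
rewrite /L; have -> : LS 0 = [:: [::]].
  rewrite /LS /LSperms -[permutations _]/[:: [::]] /=.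
  by case: ifP => // /negP []; apply/ls_wordP.
by rewrite big_seq1 -/(weight _) weightE /= gap_id mulr1.
Qed.

Lemma H_expansion n N : (3 * n + 10 < N)%N ->
  H n.+1 = expansion N (3 * n%:Z) (h n.+1).
Proof.
elim: n => [|n IH] ltN.
  by rewrite H_derivL L0 Dz (h1_expansion (N := N)) //; lia.
rewrite H_derivL (L_expansion_of_H _ (IH _)); try lia.
rewrite D_expansion; [|exact: supported_ell|lia].
apply: eq_expansion => [|i j]; first by rewrite intS; ring.
by rewrite h_rec // /deriv_coef intS; ring.
Qed.

Lemma L_expansion n N : (3 * n + 10 < N)%N ->
  L n.+1 = expansion N (3 * n%:Z + 4) (ell n.+1).
Proof. by move=> ltN; apply: L_expansion_of_H (H_expansion ltN). Qed.

(** * Restriction to the stated summation ranges *)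

Lemma big_nat_supp (V : nmodType) (a b N : nat) (F : nat -> V) :
  (a <= b <= N)%N -> (forall k, F k = 0 \/ (a <= k < b)%N) ->
  \sum_(0 <= k < N) F k = \sum_(a <= k < b) F k.
Proof.
move=> /andP [ab bN] suppF.
have zero m n : (n <= a)%N || (b <= m)%N -> \sum_(m <= k < n) F k = 0.
  by move=> mn; rewrite big_nat big1 // => k; case: (suppF k) => // kab; lia.
rewrite (@big_cat_nat _ _ _ a) ?(leq_trans ab) //= zero ?leqnn // add0r.
by rewrite (@big_cat_nat _ _ _ b) //= [X in _ + X]zero ?leqnn ?orbT // addr0.
Qed.

(** The bound [i1 <= d.+1] keeps the subtraction [d - i] from truncating, and [j0 <= 1] keeps the
    inner range from starting beyond its end. *)
Lemma expansion_nat (N d : nat) (f : int -> int -> int) (i0 i1 j0 : nat) :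
    (i0 <= i1 <= d.+1)%N -> (j0 <= 1)%N -> (d < N)%N ->
    (forall i j, f i j = 0 \/
       [&& i0%:Z <= i < i1%:Z, j0%:Z <= j & i + 2 * j <= d%:Z]) ->
  expansion N d f =
  \sum_(i0 <= i < i1) z ^+ i *
    \sum_(j0 <= j < ((d - i) %/ 2).+1)
      (f i%:Z j%:Z)%:~R * (x * y) ^+ j * (x + y) ^+ (d - i - 2 * j).
Proof.
move=> /andP [i01 i1d] j01 dN suppf.
have z0 (i j : nat) :
    ~~ [&& i0%:Z <= i%:Z < i1%:Z, j0%:Z <= j%:Z & i%:Z + 2 * j%:Z <= d%:Z] ->
    f i j = 0.
  by case: (suppf i j) => // ->.
rewrite /expansion (@big_nat_supp _ i0 i1); last first.
- move=> i; have [/andP [i0i ii1]|ni] := boolP (i0 <= i < i1)%N; first by right.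
  by left; rewrite big1 // => j _; rewrite z0 ?mono0 //; lia.
- lia.
apply: eq_big_nat => i /andP [i0i ii1].
rewrite (@big_nat_supp _ j0 ((d - i) %/ 2).+1); last first.
- move=> j; have [?|nj] := boolP (j0 <= j < ((d - i) %/ 2).+1)%N.
    by right.
  by left; rewrite z0 ?mono0 //; lia.
- lia.
rewrite [RHS]big_distrr /=. apply: eq_big_nat => j jr.
rewrite /mono (_ : absz (d%:Z - i%:Z - 2 * j%:Z)%R = d - i - 2 * j)%N; last lia.
by rewrite !absz_nat; ring.
Qed.

Theorem theorem12 :
  (forall i j : int, ell 1 i j = if (i == 2) && (j == 1) then 2 else 0) /\
  (forall n : nat, (1 <= n)%N ->
     H n = \sum_(0 <= i < (2 * n - 2).+1)
             z ^+ i *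
             \sum_(0 <= j < ((3 * n - 3 - i) %/ 2).+1)
               (h n i%:Z j%:Z)%:~R * (x * y) ^+ j
               * (x + y) ^+ (3 * n - 3 - i - 2 * j)
     /\
     L n = \sum_(1 <= i < (2 * n).+1)
             z ^+ i *
             \sum_(1 <= j < ((3 * n + 1 - i) %/ 2).+1)
               (ell n i%:Z j%:Z)%:~R * (x * y) ^+ j
               * (x + y) ^+ (3 * n + 1 - i - 2 * j)).
Proof.
split=> [i j|[//|n] _].
  case: (ell_supp 0 i j) => [e|]; last first.
    rewrite /ell_support => ij.
    (* For [n = 1] the support leaves only [j = 1] and two values of [i], settled by computation. *)
    have -> : j = 1 by lia.
    by have [-> | ->] : i = 1 \/ i = 2 by lia.
  by rewrite e; case: ifP => // /andP [/eqP ei /eqP ej]; move: e; rewrite ei ej.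
split.
  rewrite (@H_expansion _ (3 * n + 11)); last lia.
  rewrite (_ : 3 * n.+1 - 3 = 3 * n)%N; last lia.
  rewrite (_ : 3 * n%:Z = (3 * n)%N); last lia.
  apply: expansion_nat; try lia.
  move=> i j; case: (h_supp n i j); first by left.
  by rewrite /h_support; right; lia.
rewrite (@L_expansion _ (3 * n + 11)); last lia.
rewrite (_ : 3 * n.+1 + 1 = 3 * n + 4)%N; last lia.
rewrite (_ : 3 * n%:Z + 4 = (3 * n + 4)%N); last lia.
apply: expansion_nat; try lia.
move=> i j; case: (ell_supp n i j); first by left.
by rewrite /ell_support; right; lia.
Qed.
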